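(* Let $F=f+\psi$ satisfy Assumption A (see context), let $(x_k)_{k\ge 0}$ be generated by algorithm SCPG, let the well-alignment Assumption B hold with parameters $\alpha,\delta\in(0,1)$, and suppose that the sublevel set $\mathcal{L}_F(x_0)=\{x: F(x)\le F(x_0)\}$ is bounded. Then for every integer $K\ge 0$ and every $\beta\in(0,1)$, $$\mathbb{P}\left[\min_{0\le i\le K}\|\nabla F(x_i)\|^2\le \frac{F(x_0)-F^*}{C(1-\beta)(1-\delta)(K+1)}\right]\ \ge\ 1-e^{-\frac{\beta^2}{2}(1-\delta)(K+1)},$$ where $C=\dfrac{\alpha^2\eta_{\min}}{2H_{F,\max}^2}$.
   Context: Norms of vectors are Euclidean; norms of matrices are spectral unless marked $\|\cdot\|_F$ (Frobenius). Problem: $F^*=\min_{x\in\mathbb{R}^n}F(x)$, $F=f+\psi$. Assumption A: $\mathcal{U}\subset\mathbb{R}^{n\times p}$ is a bounded family of matrices. (A.1) $f:\mathbb{R}^n\to\mathbb{R}$ is continuously differentiable (possibly nonconvex) and for each $U\in\mathcal{U}$ there is $L_U$ with $\|U^T(\nabla f(x+Uh)-\nabla f(x))\|\le L_U\|h\|$ for all $x\in\mathbb{R}^n$, $h\in\mathbb{R}^p$. (A.2) $\psi:\mathbb{R}^n\to\mathbb{R}$ is twice continuously differentiable (possibly nonseparable and nonconvex). (A.3) The minimum $F^*$ is attained (so $F^*>-\infty$). $\psi$ is convex along the subspaces from $\mathcal{U}$ if for every $x\in\mathbb{R}^n$ and $U\in\mathcal{U}$ the function $d\mapsto\psi(x+Ud)$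 is convex on $\mathbb{R}^p$. Algorithm SCPG: given a deterministic $x_0\in\mathbb{R}^n$, at each iteration $k\ge 0$ sample a random $U_k\in\mathcal{U}$, choose $\eta_{U_k}>0$, set $H_{f,U_k}=\frac{L_{U_k}+\eta_{U_k}}{2}$ if $\psi$ is convex along the subspaces from $\mathcal{U}$, and $H_{f,U_k}=L_{U_k}+\eta_{U_k}$ otherwise; take $$d_k\in\arg\min_{d\in\mathbb{R}^p} f(x_k)+\langle U_k^T\nabla f(x_k),d\rangle+\frac{H_{f,U_k}}{2}\|d\|^2+\psi(x_k+U_kd)$$ and set $x_{k+1}=x_k+U_kd_k$. Thus $x_k$ is determined by $U_0,\dots,U_{k-1}$. Well-alignment: $U_k$ is well-aligned if $\|U_k^T\nabla F(x_k)\|\ge\alpha\|\nabla F(x_k)\|$, where $\alpha\in(0,1)$ is fixed independently of $k$. Assumption B: for every $k$, conditionally on $U_0,\dots,U_{k-1}$, the matrix $U_k$ is well-aligned (for the fixed $\alpha$) with probability at least $1-\delta$, $\delta\in(0,1)$. Constants: for $z_1,\dots,z_n\in\mathbb{R}^n$ let $\bar\nabla^2\Psi(z_1,\dots,z_n)$ be the $n\times n$ matrix whose $i$-th row is the $i$-th row of the Hessian $\nabla^2\psi(z_i)$, and let $$H_{F,U_k}=\max_{z_1,\dots,z_n\in\mathrm{conv}(\mathcal{L}_F(x_0))}\|U_k^T\bar\nabla^2\Psi(z_1,\dots,z_n)U_k+H_{f,U_k}I_p\|_F .$$ It is assumed that there are constants $0<H_{F,\max}<\infty$ and $\eta_{\min}>0$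 with $H_{F,U_k}\le H_{F,\max}$ and $\eta_{U_k}\ge\eta_{\min}$ for all $k\ge 0$ (the paper sets $\eta_{\min}=\min_k\eta_{U_k}$). *)

(* Defs.v *)
From HB Require Import structures.
From mathcomp Require Import all_boot all_order all_algebra.
From mathcomp Require Import all_classical all_reals all_analysis.

Set Implicit Arguments.
Unset Strict Implicit.
Unset Printing Implicit Defensive.

Import Order.TTheory GRing.Theory Num.Theory.
Import numFieldNormedType.Exports.

Local Open Scope classical_set_scope.
Local Open Scope ring_scope.

Section Euclidean.
Context {R : realType}.

(* The norm carried by the library on matrices is the entrywise maximum.  It
   induces the same topology and bounded sets, so it is used for continuity,
   differentiability and boundedness; everything quantitative uses [fnorm],
   which is the Euclidean norm on column vectors. *)
Definition fnorm m n (A : 'M[R]_(m, n)) : R :=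
  Num.sqrt (\sum_i \sum_j A i j ^+ 2).

Definition dot n (u v : 'cV[R]_n) : R := \sum_i u i 0 * v i 0.

Definition argmin (V : Type) (g : V -> R) : set V :=
  [set v | forall v', g v <= g v'].

Definition conv_hull (V : lmodType R) (A : set (convex_lmodType V)) : set V :=
  smallest (@convex_set R V) A.

End Euclidean.

Section Calculus.
Context {R : realType} {n : nat}.
Implicit Types g : 'cV[R]_n -> R.

Definition grad g (x : 'cV[R]_n) : 'cV[R]_n :=
  \col_i 'D_(delta_mx i 0) g x.

Definition hessian g (x : 'cV[R]_n) : 'M[R]_n :=
  \matrix_(i, j) 'D_(delta_mx j 0) (fun y => grad g y i 0) x.

Definition C1 g : Prop :=
  (forall x, differentiable g x) /\ continuous (grad g).

Definition C2 g : Prop :=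
  [/\ C1 g, forall x, differentiable (grad g) x & continuous (hessian g)].

Definition mixed_hessian g (z : 'I_n -> 'cV[R]_n) : 'M[R]_n :=
  \matrix_(i, j) hessian g (z i) i j.

Definition sublevel g (x0 : 'cV[R]_n) : set 'cV[R]_n := [set x | g x <= g x0].

End Calculus.

Section Problem.
Context {R : realType} {n p : nat}.
Variables (f psi : 'cV[R]_n -> R) (UU : set 'M[R]_(n, p)).

Definition block_lipschitz (L : 'M[R]_(n, p) -> R) : Prop :=
  forall U, UU U -> forall (x : 'cV[R]_n) (h : 'cV[R]_p),
    fnorm (U^T *m (grad f (x + U *m h) - grad f x)) <= L U * fnorm h.

Definition assumption_A (L : 'M[R]_(n, p) -> R) : Prop :=
  [/\ bounded_set UU,
      C1 f /\ block_lipschitz L,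
      C2 psi
    & exists xs, forall x, (f \+ psi) xs <= (f \+ psi) x].

Definition convex_along : Prop :=
  forall (x : 'cV[R]_n) (U : 'M[R]_(n, p)), UU U ->
    convex_function [set: convex_lmodType 'cV[R]_p]
      (fun d : 'cV[R]_p => psi (x + U *m d)).

(* l and eta stand for L_U and eta_U. *)
Definition Hf (l eta : R) : R :=
  if `[< convex_along >] then (l + eta) / 2 else l + eta.

Definition model (h : R) (x : 'cV[R]_n) (U : 'M[R]_(n, p)) (d : 'cV[R]_p) : R :=
  f x + dot (U^T *m grad f x) d + h / 2 * fnorm d ^+ 2 + psi (x + U *m d).

(* The supremum is a maximum when the sublevel set of F = f + psi is bounded:
   it is then compact, and so is its convex hull. *)
Definition HF (x0 : 'cV[R]_n) (U : 'M[R]_(n, p)) (h : R) : R :=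
  sup [set fnorm (U^T *m mixed_hessian psi z *m U + h%:M) |
        z in [set z : 'I_n -> 'cV[R]_n |
               forall i, conv_hull (sublevel (f \+ psi) x0) (z i)]].

Definition well_aligned (alpha : R) (x : 'cV[R]_n) (U : 'M[R]_(n, p)) : Prop :=
  alpha * fnorm (grad (f \+ psi) x) <= fnorm (U^T *m grad (f \+ psi) x).

End Problem.

Section Probability.
Context {R : realType} {d : measure_display} {T : measurableType d}.
Variable P : probability T R.

(* [q] is a version of P(A | <<s G >>). *)
Definition is_cond_prob (G : set (set T)) (A : set T) (q : T -> R) : Prop :=
  [/\ measurable_fun [set: g_sigma_algebraType G] q,
      P.-integrable setT (EFin \o q)
    & forall E, <<s G >> E -> (\int[P]_(w in E) (q w)%:E = P (A `&` E))%E].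

Section Process.
Context {n p : nat}.
Variable U : nat -> T -> 'M[R]_(n, p).

(* Generators of the sigma-algebra of U_0, ..., U_{k-1}. *)
Definition history (k : nat) : set (set T) :=
  [set A | exists i a b, (i < k)%N /\
     preimage_set_system setT (fun w => U i w a b) measurable A].

(* Minimizers of the model need not be unique, so it is part of the algorithm
   that d_k is selected measurably from U_0, ..., U_k. The step parameters
   eta k may depend on k and on the whole outcome, not only on U_k. *)
Record SCPG (f psi : 'cV[R]_n -> R) (UU : set 'M[R]_(n, p))
    (L : 'M[R]_(n, p) -> R) (eta : nat -> T -> R) (x0 : 'cV[R]_n)
    (D : nat -> T -> 'cV[R]_p) (x : nat -> T -> 'cV[R]_n) : Prop := {
  SCPG_rand : forall k i j, measurable_fun [set: T] (fun w => U k w i j) ;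
  SCPG_family : forall k w, UU (U k w) ;
  SCPG_eta : forall k w, 0 < eta k w ;
  SCPG_init : forall w, x 0%N w = x0 ;
  SCPG_argmin : forall k w,
    argmin (model f psi (Hf psi UU (L (U k w)) (eta k w)) (x k w) (U k w))
      (D k w) ;
  SCPG_select : forall k i,
    measurable_fun [set: g_sigma_algebraType (history k.+1)]
      (fun w => D k w i 0) ;
  SCPG_step : forall k w, x k.+1 w = x k w + U k w *m D k w }.

Definition assumption_B (f psi : 'cV[R]_n -> R) (x : nat -> T -> 'cV[R]_n)
    (alpha delta : R) : Prop :=
  forall k, exists2 q : T -> R,
    is_cond_prob (history k)
      [set w | well_aligned f psi alpha (x k w) (U k w)] q
    & {ae P, forall w, 1 - delta <= q w}.

End Process.
End Probability.

(* Main.v *)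
(* Comparing the minimizer d_k of the model with d = 0 and using the descent lemma
   gives F(x_{k+1}) <= F(x_k) - eta_{U_k}/2 |d_k|^2; when psi is convex along
   the subspaces, strong convexity of the model doubles the gain, which
   compensates for the halved H_{f,U_k}. Stationarity of d_k and a mean value
   theorem for each component of the gradient of psi give U_k^T grad F(x_k) =
   -(U_k^T M U_k + H_{f,U_k} I) d_k, where the i-th row of M is a row of the
   Hessian of psi at a point of the segment from x_k to x_{k+1}, so |U_k^T grad
   F(x_k)| <= H_{F,U_k} |d_k|. Hence every well-aligned step decreases F by at
   least C |grad F(x_k)|^2.

   It remains to bound below the number N_k of well-aligned steps before time k. As
   each {N_k = j} is determined by U_0, ..., U_{k-1}, Assumption B bounds P(step
   k aligned, N_k = j) below by (1-delta) P(N_k = j), so E[(1-beta)^{N_k}]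
   shrinks by the factor 1 - beta (1-delta) at each step, and Markov's
   inequality yields the multiplicative Chernoff bound. *)

Require Import Defs.
From mathcomp Require Import all_boot all_order all_algebra.
From mathcomp Require Import all_classical all_reals all_analysis.
From mathcomp Require Import ring lra measurable_realfun.
Import Order.TTheory GRing.Theory Num.Theory.
Import numFieldNormedType.Exports.
Local Open Scope classical_set_scope.
Local Open Scope ring_scope.

Set Implicit Arguments.
Unset Strict Implicit.
Unset Printing Implicit Defensive.

(** * Euclidean and Frobenius norms *)

Section EuclideanNorm.
Context {R : realType}.

Lemma fnorm_ge0 m n (A : 'M[R]_(m, n)) : 0 <= fnorm A.
Proof. exact: sqrtr_ge0. Qed.

Lemma sqr_fnorm m n (A : 'M[R]_(m, n)) :
  fnorm A ^+ 2 = \sum_i \sum_j A i j ^+ 2.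
Proof.
by rewrite sqr_sqrtr// sumr_ge0// => i _; rewrite sumr_ge0// => j _; rewrite sqr_ge0.
Qed.

Lemma fnormN m n (A : 'M[R]_(m, n)) : fnorm (- A) = fnorm A.
Proof.
congr Num.sqrt; apply: eq_bigr => i _; apply: eq_bigr => j _.
by rewrite mxE sqrrN.
Qed.

Lemma dotE n (u v : 'cV[R]_n) : dot u v = (u^T *m v) 0 0.
Proof. by rewrite mxE; apply: eq_bigr => i _; rewrite mxE. Qed.

Lemma dotC n (u v : 'cV[R]_n) : dot u v = dot v u.
Proof. by apply: eq_bigr => i _; rewrite mulrC. Qed.

Lemma dotDr n (u v w : 'cV[R]_n) : dot u (v + w) = dot u v + dot u w.
Proof. by rewrite !dotE mulmxDr mxE. Qed.

Lemma dotDl n (u v w : 'cV[R]_n) : dot (v + w) u = dot v u + dot w u.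
Proof. by rewrite dotC dotDr !(dotC u). Qed.

Lemma dotZr n a (u v : 'cV[R]_n) : dot u (a *: v) = a * dot u v.
Proof. by rewrite !dotE -scalemxAr mxE. Qed.

Lemma dotZl n a (u v : 'cV[R]_n) : dot (a *: v) u = a * dot v u.
Proof. by rewrite dotC dotZr dotC. Qed.

Lemma dot0r n (u : 'cV[R]_n) : dot u 0 = 0.
Proof. by rewrite dotE mulmx0 mxE. Qed.

Lemma dotBl n (u v w : 'cV[R]_n) : dot (v - w) u = dot v u - dot w u.
Proof. by rewrite -scaleN1r dotDl dotZl mulN1r. Qed.

Lemma dot_trmul n p (U : 'M[R]_(n, p)) (u : 'cV[R]_n) (v : 'cV[R]_p) :
  dot (U^T *m u) v = dot u (U *m v).
Proof. by rewrite !dotE trmx_mul trmxK mulmxA. Qed.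

Lemma dotvv n (u : 'cV[R]_n) : dot u u = fnorm u ^+ 2.
Proof.
rewrite sqr_fnorm; apply: eq_bigr => i _.
by rewrite big_ord_recl big_ord0 addr0 expr2.
Qed.

Lemma dotvv_eq0 n (u : 'cV[R]_n) : dot u u = 0 -> u = 0.
Proof.
move=> /eqP; rewrite psumr_eq0 => [/allP u0|i _]; last by rewrite -expr2 sqr_ge0.
apply/matrixP => i j; rewrite ord1 mxE.
by have /eqP := u0 i (mem_index_enum i) => /eqP; rewrite mulf_eq0 orbb => /eqP.
Qed.

Lemma sqr_dot_le n (u v : 'cV[R]_n) : dot u v ^+ 2 <= dot u u * dot v v.
Proof.
have [v0|v0] := eqVneq (dot v v) 0.
  by rewrite (dotvv_eq0 v0) !dot0r expr0n mulr0.
have vp : 0 < dot v v by rewrite lt_neqAle eq_sym v0 dotvv sqr_ge0.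
have := sqr_ge0 (fnorm (dot v v *: u - dot u v *: v)).
rewrite -dotvv dotBl !dotZl -[- _]scaleN1r !dotDr !dotZr (dotC v u) => h.
have : 0 <= dot v v * (dot u u * dot v v - dot u v ^+ 2) by lra.
by rewrite pmulr_rge0// subr_ge0.
Qed.

Lemma dot_le n (u v : 'cV[R]_n) : dot u v <= fnorm u * fnorm v.
Proof.
rewrite (le_trans (ler_norm _))// -ler_sqr ?nnegrE ?mulr_ge0 ?fnorm_ge0//.
by rewrite real_normK ?num_real// exprMn -!dotvv sqr_dot_le.
Qed.

(** Cauchy-Schwarz on each row of [A], summed over the rows. *)
Lemma fnorm_mul_le m n (A : 'M[R]_(m, n)) (v : 'cV[R]_n) :
  fnorm (A *m v) <= fnorm A * fnorm v.
Proof.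
rewrite -ler_sqr ?nnegrE ?mulr_ge0 ?fnorm_ge0// exprMn (sqr_fnorm A) (sqr_fnorm (_ *m _)).
rewrite mulr_suml ler_sum// => i _.
have -> : \sum_j A i j ^+ 2 = dot (row i A)^T (row i A)^T.
  by apply: eq_bigr => j _; rewrite !mxE expr2.
rewrite big_ord_recl big_ord0 addr0 -dotvv.
have -> : (A *m v) i 0 = dot (row i A)^T v.
  by rewrite mxE; apply: eq_bigr => j _; rewrite !mxE.
exact: sqr_dot_le.
Qed.

End EuclideanNorm.

(** * Restriction to lines and the mean value theorem *)

Section Lines.
Context {R : realType}.

(** The difference quotients of [g] along [v] and of its restriction to the line are the same
    function of [h]. *)
Lemma derive_along_line (V W : normedModType R) (g : V -> W) (x v : V) (t : R) :
  derivable g (x + t *: v) v ->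
  is_derive t 1 (fun s => g (x + s *: v)) ('D_v g (x + t *: v)).
Proof.
have E : (fun h : R => h^-1 *: ((g \o shift (x + t *: v)) (h *: v) - g (x + t *: v))) =
  (fun h : R => h^-1 *: (((fun s => g (x + s *: v)) \o shift t) (h *: 1) - g (x + t *: v))).
  apply/funext => h /=; congr (_ *: (g _ - _)).
  by rewrite addrCA scalerDl [h%:A]mulr1.
rewrite /derivable /derive /= => dg.
by apply: DeriveDef; rewrite /derivable /derive /= -E.
Qed.

Lemma continuous_along_line (V W : normedModType R) (g : V -> W) (x v : V) :
  (forall y, differentiable g y) -> continuous (fun s : R => g (x + s *: v)).
Proof.
move=> dg t; apply: differentiable_continuous; apply/derivable1_diffP.
have dl : derivable g (x + t *: v) v by exact/diff_derivable/dg.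
by have [] := derive_along_line dl.
Qed.

Lemma mvt_line (V : normedModType R) (g : V -> R) (x v : V) :
  (forall y, differentiable g y) ->
  exists2 t, 0 <= t <= 1 & g (x + v) - g x = 'D_v g (x + t *: v).
Proof.
move=> dg.
have [||t] := @MVT_segment _ (fun s : R => g (x + s *: v))
  (fun s => 'D_v g (x + s *: v)) 0 1 ler01.
- by move=> s _; exact/derive_along_line/diff_derivable.
- by apply: continuous_subspaceT; exact: continuous_along_line.
rewrite in_itv/= scale1r scale0r addr0 subr0 mulr1 => t01 E.
by exists t.
Qed.

End Lines.

(** * Gradients and directional derivatives *)

Section Gradient.
Context {R : realType} {n : nat}.
Implicit Types (g : 'cV[R]_n -> R) (x v : 'cV[R]_n).

Lemma col_sum_delta v : v = \sum_i v i 0 *: delta_mx i 0.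
Proof.
rewrite [LHS]matrix_sum_delta; apply: eq_bigr => i _.
by rewrite big_ord_recl big_ord0 addr0.
Qed.

Lemma derive_grad g x v : differentiable g x -> 'D_v g x = dot (grad g x) v.
Proof.
move=> dg; rewrite deriveE// {1}(col_sum_delta v) linear_sum.
by apply: eq_bigr => i _; rewrite linearZ /= mxE deriveE// mulrC.
Qed.

Lemma gradD f g x : differentiable f x -> differentiable g x ->
  grad (f \+ g) x = grad f x + grad g x.
Proof.
by move=> df dg; apply/matrixP => i j; rewrite !mxE deriveD//; exact: diff_derivable.
Qed.

Lemma is_derive_grad_line g x v (t : R) : (forall y, differentiable g y) ->
  is_derive t 1 (fun s : R => g (x + s *: v)) (dot (grad g (x + t *: v)) v).
Proof.
by move=> dg; rewrite -derive_grad//; exact/derive_along_line/diff_derivable.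
Qed.

End Gradient.

(** * One step of the algorithm *)

Section Step.
Context {R : realType} {n p : nat}.
Variables (f psi : 'cV[R]_n -> R) (UU : set 'M[R]_(n, p)).
Variable L : 'M[R]_(n, p) -> R.
Implicit Types (x : 'cV[R]_n) (d v : 'cV[R]_p) (U : 'M[R]_(n, p)).

(** Along the segment, let [G] be [f] minus its linear term and the quadratic bound. The Lipschitz
    condition at [t *: d] and Cauchy-Schwarz make its derivative nonpositive, so the mean value
    theorem gives [G 1 <= G 0], which is the claim. *)
Lemma descent_lemma U x d :
  (forall y, differentiable f y) -> block_lipschitz f UU L -> UU U ->
  f (x + U *m d) <= f x + dot (U^T *m grad f x) d + L U / 2 * fnorm d ^+ 2.
Proof.
move=> df lipf UUU.
pose G (s : R) := f (x + s *: (U *m d)) - s * dot (grad f x) (U *m d)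
  - L U / 2 * fnorm d ^+ 2 * s ^+ 2.
pose dG (s : R) := dot (grad f (x + s *: (U *m d))) (U *m d) - dot (grad f x) (U *m d)
  - L U * fnorm d ^+ 2 * s.
have GdG (s : R) : is_derive s 1 G (dG s).
  have dfs := is_derive_grad_line x (U *m d) s df.
  rewrite /G /dG; apply: is_derive_eq.
  by rewrite /GRing.scale /=; lra.
have [|t] := @MVT _ G dG 0 1 ltr01 (fun s _ => GdG s).
  apply: continuous_subspaceT => s.
  by apply: differentiable_continuous; apply/derivable1_diffP; have [] := GdG s.
rewrite in_itv/= => /andP[t0 t1].
rewrite subr0 mulr1 /G scale1r scale0r addr0 mul0r mul1r expr0n/= mulr0 expr1n mulr1.
have : dG t <= 0.
  have := lipf _ UUU x (t *: d); rewrite -scalemxAr.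
  have -> : fnorm (t *: d) = t * fnorm d.
    apply/eqP; rewrite -(@eqrXn2 _ 2)// ?mulr_ge0 ?fnorm_ge0 ?(ltW t0)//.
    by rewrite exprMn -!dotvv dotZr dotZl; apply/eqP; ring.
  rewrite /dG -dotBl -dot_trmul => h.
  have := dot_le (U^T *m (grad f (x + t *: (U *m d)) - grad f x)) d.
  have := fnorm_ge0 d; set a := fnorm d in h *; set b := fnorm _ in h *.
  by set c := dot _ _; nra.
by rewrite dot_trmul; lra.
Qed.

Section Minimizer.
Variables (h : R) (x : 'cV[R]_n) (U : 'M[R]_(n, p)) (d : 'cV[R]_p).
Hypothesis dmin : argmin (model f psi h x U) d.

Lemma model_argmin_le0 :
  f x + dot (U^T *m grad f x) d + h / 2 * fnorm d ^+ 2 + psi (x + U *m d)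
  <= f x + psi x.
Proof.
have := dmin 0; rewrite /model mulmx0 !addr0 dot0r addr0.
by rewrite -(dotvv 0) dot0r mulr0 addr0.
Qed.

(* The model is h-strongly convex along the segment from d to 0, which doubles
   the quadratic term of model_argmin_le0. *)
Lemma model_argmin_convex_le0 : convex_along psi UU -> UU U ->
  f x + dot (U^T *m grad f x) d + h * fnorm d ^+ 2 + psi (x + U *m d)
  <= f x + psi x.
Proof.
move=> cpsi UUU.
set g := dot (U^T *m grad f x) d; set e := fnorm d ^+ 2.
(* Comparing [d] with [(1 - t) *: d] yields [t] times the desired inequality, up to an error of
   order [t ^+ 2]. Dividing by [t] leaves an error linear in [t], which is then made arbitrarily
   small. *)
have key (t : R) : 0 < t -> t < 1 ->
    g + psi (x + U *m d) - psi x + h * e - h / 2 * e * t <= 0.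
  move=> t0 t1.
  have t01 : 0 <= t <= 1 by rewrite !ltW.
  have tI : Itv.spec (@Itv.num_sem R) (Itv.Real `[0%Z, 1%Z]) t.
    by rewrite /Itv.spec/= /Itv.num_sem/= num_real/= in_itv/=.
  have cv : psi (x + U *m ((1 - t) *: d)) <=
      t * psi x + (1 - t) * psi (x + U *m d).
    have := cpsi x U UUU (Itv.mk tI) 0 d (in_setT _) (in_setT _).
    rewrite [X in psi (x + U *m X)](_ : _ = (1 - t) *: d).
      by rewrite convRE/= mulmx0 addr0.
    by rewrite -[RHS]add0r -[X in X + _](scaler0 _ t).
  have := dmin ((1 - t) *: d); rewrite /model dotZr -!dotvv dotZr dotZl dotvv.
  rewrite -/e -/g => mv.
  have : t * (g + psi (x + U *m d) - psi x + h * e - h / 2 * e * t) <= 0.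
    by nra.
  by rewrite pmulr_rle0.
suff : g + psi (x + U *m d) - psi x + h * e <= 0 by lra.
apply/ler_addgt0Pr => _/posnumP[z]; rewrite add0r.
set w := _ + h * e in key *.
(* The error [h / 2 * e * t] stays below [z]; the summand 1 keeps the denominator positive, and the
   cap 1/2 keeps [t] below 1. *)
pose t := Num.min (1 / 2) (z%:num / (1 + `|h / 2 * e|)).
have c0 : 0 < 1 + `|h / 2 * e| by rewrite ltr_pwDl.
have t0 : 0 < t by rewrite lt_min !divr_gt0.
have t1 : t < 1 by rewrite (@le_lt_trans _ _ (1 / 2)) ?ge_min ?lexx//; lra.
have tz : t * (1 + `|h / 2 * e|) <= z%:num.
  by rewrite -ler_pdivlMr// ge_min lexx orbT.
have := key t t0 t1; have := ler_norm (h / 2 * e).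
by move: tz t0; set N := `|_|; set M := h / 2 * e; nra.
Qed.

Lemma model_argmin_stationary : (forall y, differentiable psi y) ->
  U^T *m grad f x + h *: d + U^T *m grad psi (x + U *m d) = 0.
Proof.
(* A vector orthogonal to every [s] is orthogonal to itself, hence zero. *)
move=> dpsi; suff E s : dot (U^T *m grad f x) s + h * dot d s
    + dot (U^T *m grad psi (x + U *m d)) s = 0.
  by apply: dotvv_eq0; rewrite !dotDl dotZl E.
(* The model along the line [d + t *: s], with its quadratic part expanded in [t] for
   differentiation; it is minimal at [t = 0]. *)
pose G (t : R) := f x + (dot (U^T *m grad f x) d + t * dot (U^T *m grad f x) s)
  + h / 2 * (dot d d + 2 * t * dot d s + t ^+ 2 * dot s s)
  + psi (x + U *m d + t *: (U *m s)).
have GE t : G t = model f psi h x U (d + t *: s).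
  rewrite /G /model -dotvv !(dotDr, dotDl, dotZl, dotZr) mulmxDr -scalemxAr.
  by rewrite (addrA x) (dotC s d); ring.
have dG (t : R) : is_derive t 1 G (dot (U^T *m grad f x) s
    + h / 2 * (2 * dot d s + 2 * t * dot s s)
    + dot (grad psi (x + U *m d + t *: (U *m s))) (U *m s)).
  have dps := is_derive_grad_line (x + U *m d) (U *m s) t dpsi.
  rewrite /G; apply: is_derive_eq.
  by rewrite /GRing.scale /=; lra.
have dG0 : is_derive (0 : R) 1 G 0.
  apply: (@derive1_at_min _ G (-1) 1 0).
  - lra.
  - by move=> t _; have [] := dG t.
  - by rewrite in_itv/=; lra.
  - by move=> t _; rewrite !GE scale0r addr0; exact: dmin.
have := @derive_val _ _ _ _ _ _ _ dG0; rewrite (@derive_val _ _ _ _ _ _ _ (dG 0)).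
by rewrite scale0r addr0 !dot_trmul => <-; field.
Qed.

End Minimizer.
End Step.

(** * Convex hulls, bounds on Hessians and gradient differences *)

Section HessianBound.
Context {R : realType} {n p : nat}.

Lemma conv_hull_segment (V : lmodType R) (A : set V) (x v : V) (t : R) :
  A x -> A (x + v) -> 0 <= t <= 1 -> conv_hull (A : set (convex_lmodType V)) (x + t *: v).
Proof.
move=> Ax Axv t01 B [cB AB].
have tI : Itv.spec (@Itv.num_sem R) (Itv.Real `[0%Z, 1%Z]) t.
  by rewrite /Itv.spec/= /Itv.num_sem/= num_real/= in_itv/=.
have := cB (x + v) x (Itv.mk tI) (mem_set (AB _ Axv)) (mem_set (AB _ Ax)).
rewrite inE; congr B; rewrite /conv/=.
change (t *: (x + v) + (1 - t) *: x = x + t *: v).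
by rewrite scalerDr scalerBl scale1r addrC addrA subrK.
Qed.

(** Closed balls are convex, so every ball that contains [A] contains its hull. *)
Lemma conv_hull_bounded (V : normedModType R) (A : set V) :
  bounded_set A -> bounded_set (conv_hull (A : set (convex_lmodType V)) : set V).
Proof.
move=> [M [Mr AM]]; exists M; split => // N MN y; apply => {y}; split.
  move=> x y t; rewrite !inE /= => xN yN.
  change (`|t%:num *: x + (1 - t%:num) *: y| <= N).
  have t0 : 0 <= t%:num by [].
  have t1 : t%:num <= 1 by [].
  rewrite (le_trans (ler_normD _ _))// !normrZ (ger0_norm t0) ger0_norm ?subr_ge0//.
  by move: xN yN; set a := `|x|; set b := `|y|; nra.
by move=> y Ay; exact: AM.
Qed.

Lemma mx_entry_le_norm m q (A : 'M[R]_(m, q)) i j : `|A i j| <= `|A|.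
Proof.
by rewrite [leRHS]/Num.norm /= mx_normrE; apply/bigmax_geP; right; exists (i, j).
Qed.

(** The set lies in a compact box. The box consists of row vectors, to which [rV_compact] applies,
    and [g] is composed with transposition. *)
Lemma continuous_bounded_image (g : 'cV[R]_n -> R) (A : set 'cV[R]_n) :
  continuous g -> bounded_set A -> exists M, forall x, A x -> `|g x| <= M.
Proof.
move=> cg [M [Mr AM]].
(* The bound of [bounded_set] holds only for radii strictly above [M], hence [M + 1]. *)
have cB : compact [set v : 'rV[R]_n | forall i, `[(- (M + 1)), (M + 1)]%classic (v 0 i)].
  by apply: (@rV_compact _ _ (fun=> _)) => _; exact: segment_compact.
have ctr : continuous (@trmx R 1 n).
  move=> v B [P vP PB]; exists (fun i j => P j i) => [i j|w wP].
    by have := vP j i; rewrite mxE.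
  by apply: PB => i j; rewrite mxE.
have [N [Nr gN]] : bounded_set ((g \o trmx) @`
    [set v : 'rV[R]_n | forall i, `[(- (M + 1)), (M + 1)]%classic (v 0 i)]).
  apply: compact_bounded; apply: continuous_compact cB.
  apply: continuous_subspaceT => v; apply: continuous_comp; first exact: ctr.
  exact: cg.
exists (N + 1) => x Ax; apply: gN; first by rewrite ltrDl.
exists x^T; last by rewrite /= trmxK.
move=> i /=; rewrite mxE in_itv/= -ler_norml (le_trans (mx_entry_le_norm _ _ _))//.
by apply: AM => //; rewrite ltrDl.
Qed.

Lemma fnorm_le_sum m q (A : 'M[R]_(m, q)) : fnorm A <= \sum_i \sum_j `|A i j|.
Proof.
have s0 i : 0 <= \sum_j `|A i j| by rewrite sumr_ge0.
rewrite -ler_sqr ?nnegrE ?fnorm_ge0 ?sumr_ge0// sqr_fnorm.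
have sq (I : finType) (a : I -> R) : (forall i, 0 <= a i) ->
    \sum_i a i ^+ 2 <= (\sum_i a i) ^+ 2.
  move=> a0; rewrite [leRHS]expr2 mulr_suml ler_sum// => i _.
  by rewrite expr2 ler_wpM2l// (bigD1 i)//= lerDl sumr_ge0.
rewrite (le_trans _ (sq _ _ s0))// ler_sum// => i _.
rewrite (le_trans _ (sq _ _ (fun j => normr_ge0 (A i j))))// ler_sum// => j _.
by rewrite real_normK ?num_real.
Qed.

(** A real [sup] dominates the elements of its set only if the set is bounded above. It is: the
    Hessian entries are continuous, hence bounded on the bounded hull, and the norm is at most the
    sum of the absolute entries. *)
Lemma le_HF f psi (x0 : 'cV[R]_n) (U : 'M[R]_(n, p)) (h : R) z :
  C2 psi -> bounded_set (sublevel (f \+ psi) x0) ->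
  (forall i, conv_hull (sublevel (f \+ psi) x0) (z i)) ->
  fnorm (U^T *m mixed_hessian psi z *m U + h%:M) <= HF f psi x0 U h.
Proof.
move=> [_ _ chess] bs zh; rewrite /HF; apply: ub_le_sup; last by exists z.
have [B hB] : exists B, forall i j y, conv_hull (sublevel (f \+ psi) x0) y ->
    `|hessian psi y i j| <= B.
  have /choice[B hB] : forall ij : 'I_n * 'I_n, exists B, forall y,
      conv_hull (sublevel (f \+ psi) x0) y -> `|hessian psi y ij.1 ij.2| <= B.
    move=> [i j]; apply: (@continuous_bounded_image (fun y => hessian psi y i j));
      last exact: conv_hull_bounded.
    move=> y; apply: (@continuous_comp _ _ _ (hessian psi) (fun M => M i j)); first exact: chess.
    exact: coord_continuous.
  exists (\sum_ij `|B ij|) => i j y /(hB (i, j))/= /le_trans; apply.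
  by rewrite (bigD1 (i, j))//= (le_trans (ler_norm _))// lerDl sumr_ge0.
exists (\sum_i \sum_j (\sum_l (\sum_k `|U k i| * B) * `|U l j| + `|(h%:M : 'M[R]_p) i j|)).
move=> _ [w wh <-]; rewrite (le_trans (fnorm_le_sum _))//.
apply: ler_sum => i _; apply: ler_sum => j _.
rewrite mxE (le_trans (ler_normD _ _))// lerD2r mxE.
apply: (le_trans (ler_norm_sum _ _ _)); apply: ler_sum => l _.
rewrite normrM ler_wpM2r// mxE.
apply: (le_trans (ler_norm_sum _ _ _)); apply: ler_sum => k _.
by rewrite normrM mxE ler_wpM2l// mxE hB.
Qed.

Lemma grad_sub_mixed_hessian psi (x v : 'cV[R]_n) : C2 psi ->
  exists2 z : 'I_n -> 'cV[R]_n,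
    forall i, exists2 t, 0 <= t <= 1 & z i = x + t *: v
    & grad psi (x + v) - grad psi x = mixed_hessian psi z *m v.
Proof.
move=> [_ dgrad _].
have dgi i y : differentiable (fun y => grad psi y i 0) y.
  by apply: (@differentiable_comp _ _ _ _ (grad psi) (fun M => M i 0));
    [exact: dgrad|exact: differentiable_coord].
(* The mean value theorem holds only for scalar functions, so each component has its own
   intermediate point; this is why [mixed_hessian] takes one point per row. *)
have /choice[t ht] i : exists t, 0 <= t <= 1 /\
    grad psi (x + v) i 0 - grad psi x i 0 = 'D_v (fun y => grad psi y i 0) (x + t *: v).
  by have [t t01 E] := mvt_line x v (dgi i); exists t.
exists (fun i => x + t i *: v) => [i|]; first by exists (t i) => //; have [] := ht i.
apply/matrixP => i j; rewrite ord1 !mxE; have [_] := ht i; rewrite !mxE => ->.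
rewrite derive_grad//; apply: eq_bigr => k _; congr (_ * _).
by rewrite !mxE.
Qed.

End HessianBound.

(** * Decrease of the objective in one step *)

Section Decrease.
Context {R : realType} {n p : nat}.
Variables (f psi : 'cV[R]_n -> R) (UU : set 'M[R]_(n, p)).
Variables (L : 'M[R]_(n, p) -> R) (x0 : 'cV[R]_n).
Hypotheses (A : assumption_A f psi UU L) (bS : bounded_set (sublevel (f \+ psi) x0)).
Variables (eta : R) (x : 'cV[R]_n) (U : 'M[R]_(n, p)) (d : 'cV[R]_p).
Hypotheses (UUU : UU U) (dmin : argmin (model f psi (Hf psi UU (L U) eta) x U) d).

Lemma step_descent : (f \+ psi) (x + U *m d) <= (f \+ psi) x - eta / 2 * fnorm d ^+ 2.
Proof.
case: A => _ [[df _] lipf] _ _ /=.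
have := descent_lemma x d df lipf UUU.
(* Either case gains [(L U + eta) / 2] times the squared norm of [d] in the model; the descent lemma
   consumes [L U / 2] of it. *)
move: dmin; rewrite /Hf; case: asboolP => [cpsi|_] dmin'.
  by have := model_argmin_convex_le0 dmin' cpsi UUU; lra.
by have := model_argmin_le0 dmin'; lra.
Qed.

Hypotheses (eta0 : 0 <= eta) (Sx : sublevel (f \+ psi) x0 x).

(** Keeps both ends of the step in the sublevel set, so that the segment between them lies in the
    hull over which [HF] is a supremum. *)
Lemma step_sublevel : sublevel (f \+ psi) x0 (x + U *m d).
Proof.
apply: le_trans Sx; apply: le_trans step_descent _.
by rewrite gerBl mulr_ge0 ?sqr_ge0// divr_ge0.
Qed.

Lemma step_grad_le :
  fnorm (U^T *m grad (f \+ psi) x) <= HF f psi x0 U (Hf psi UU (L U) eta) * fnorm d.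
Proof.
case: A => _ [[df _] _] C2psi _.
have [[dpsi _] _ _] := C2psi.
have [z zx zE] := grad_sub_mixed_hessian x (U *m d) C2psi.
set h := Hf _ _ _ _.
have -> : U^T *m grad (f \+ psi) x = - ((U^T *m mixed_hessian psi z *m U + h%:M) *m d).
  have := model_argmin_stationary dmin dpsi; rewrite -/h => st.
  rewrite mulmxDl -!mulmxA -zE mul_scalar_mx gradD// mulmxDr mulmxBr.
  move/eqP: st; rewrite -addrA addr_eq0 => /eqP ->.
  by rewrite !opprD opprK -addrA addrC.
rewrite fnormN (le_trans (fnorm_mul_le _ _))// ler_wpM2r ?fnorm_ge0// le_HF//.
by move=> i; have [t t01 ->] := zx i; apply: conv_hull_segment => //; exact: step_sublevel.
Qed.

Lemma step_aligned_decrease alpha eta_min HFmax : 0 <= alpha -> 0 < HFmax ->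
  0 <= eta_min <= eta -> HF f psi x0 U (Hf psi UU (L U) eta) <= HFmax ->
  well_aligned f psi alpha x U ->
  alpha ^+ 2 * eta_min / (2 * HFmax ^+ 2) * fnorm (grad (f \+ psi) x) ^+ 2
  <= (f \+ psi) x - (f \+ psi) (x + U *m d).
Proof.
move=> a0 H0 /andP[e0 ee] HFle wa.
have gd : alpha * fnorm (grad (f \+ psi) x) <= HFmax * fnorm d.
  by rewrite (le_trans wa)// (le_trans step_grad_le)// ler_wpM2r ?fnorm_ge0.
have gd2 : alpha ^+ 2 * fnorm (grad (f \+ psi) x) ^+ 2 <= HFmax ^+ 2 * fnorm d ^+ 2.
  by rewrite -!exprMn ler_sqr ?nnegrE ?mulr_ge0 ?fnorm_ge0// ltW.
have H2 : 0 < HFmax ^+ 2 by rewrite exprn_gt0.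
apply: (@le_trans _ _ (eta_min / 2 * fnorm d ^+ 2)); last first.
  by have := step_descent; have := sqr_ge0 (fnorm d); nra.
rewrite (_ : _ / _ * _ = eta_min / 2 *
    ((alpha ^+ 2 * fnorm (grad (f \+ psi) x) ^+ 2) / HFmax ^+ 2)); last first.
  by field; rewrite gt_eqF.
by rewrite ler_wpM2l ?divr_ge0// ler_pdivrMr// [leRHS]mulrC.
Qed.

End Decrease.

(** * Chernoff bound for adapted events *)

Section ChernoffExponent.
Context {R : realType}.

(** The difference [G] of the two sides vanishes at 1 and has derivative [ln s + 1 - s], nonpositive
    because [ln s <= s - 1]. *)
Lemma xlnx_ge (y : R) : 0 < y <= 1 -> (y ^+ 2 - 1) / 2 <= y * ln y.
Proof.
move=> /andP[y0 y1].
pose G (s : R) := s * ln s - (s ^+ 2 - 1) / 2.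
pose dG (s : R) := ln s + 1 - s.
have GdG (s : R) : 0 < s -> is_derive s 1 G (dG s).
  move=> s0; have dln := is_derive1_ln s0.
  rewrite /G /dG; apply: is_derive_eq.
  by rewrite /GRing.scale /=; field; rewrite gt_eqF.
have [s||s] := @MVT_segment _ G dG y 1 y1.
- by rewrite in_itv/= => /andP[ys _]; apply: GdG; exact: lt_trans ys.
- apply: continuous_in_subspaceT => s; rewrite inE/= in_itv/= => /andP[ys _].
  apply: differentiable_continuous; apply/derivable1_diffP.
  by have [] := GdG s (lt_le_trans y0 ys).
rewrite in_itv/= => /andP[ys s1]; rewrite /G /dG ln1.
have s0 : 0 < s by exact: lt_le_trans ys.
have : ln s <= s - 1.
  by rewrite -[in ln s](subrK 1 s) [s - 1 + 1]addrC le_ln1Dx//; lra.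
by nra.
Qed.

(** Bound [1 - b * q] by [expR (- (b * q))] and collect exponents; what remains is
    [(1 - b) * ln (1 - b) + b >= b ^+ 2 / 2], which is [xlnx_ge] at [1 - b]. *)
Lemma chernoff_exponent (b q : R) (K : nat) : 0 < b < 1 -> 0 <= q < 1 ->
  (1 - b) `^ (- ((1 - b) * q * K%:R)) * (1 - b * q) ^+ K
  <= expR (- (b ^+ 2 / 2 * q * K%:R)).
Proof.
move=> /andP[b0 b1] /andP[q0 q1].
have b10 : 0 < 1 - b by lra.
have -> : (1 - b) `^ (- ((1 - b) * q * K%:R)) =
    expR (- ((1 - b) * q * K%:R) * ln (1 - b)) by rewrite /powR gt_eqF.
have bq : 0 <= 1 - b * q by nra.
apply: (@le_trans _ _ (expR (- ((1 - b) * q * K%:R) * ln (1 - b)) * expR (- (b * q) * K%:R))).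
  rewrite ler_wpM2l ?expR_ge0// expRM_natr.
  by rewrite lerXn2r ?nnegrE ?expR_ge0// expR_ge1Dx.
rewrite -expRD ler_expR.
have := @xlnx_ge (1 - b) ltac:(lra); set l := _ * ln _ => lb.
have -> : - ((1 - b) * q * K%:R) * ln (1 - b) + - (b * q) * K%:R =
  - ((l + b) * (q * K%:R)) by rewrite /l; ring.
have -> : b ^+ 2 / 2 * q * K%:R = b ^+ 2 / 2 * (q * K%:R) by ring.
by rewrite lerN2 ler_wpM2r ?mulr_ge0//; lra.
Qed.

End ChernoffExponent.

(** * Counting the events that occur *)

Section Occurrences.
Context {T : Type}.
Variable A : nat -> set T.

Definition occurrences (k : nat) (w : T) : nat := \sum_(i < k) (w \in A i).

Definition occurs_exactly (k j : nat) : set T := [set w | occurrences k w = j].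

Lemma occurs_exactly00 : occurs_exactly 0 0 = setT.
Proof. by apply/seteqP; split => // w _; rewrite /occurs_exactly/= /occurrences big_ord0. Qed.

Lemma occurs_exactly0S j : occurs_exactly 0 j.+1 = set0.
Proof. by apply/seteqP; split => // w; rewrite /occurs_exactly/= /occurrences big_ord0. Qed.

Lemma occurs_exactlyS0 k : occurs_exactly k.+1 0 = occurs_exactly k 0 `\` A k.
Proof.
apply/seteqP; split => w; rewrite /occurs_exactly/= /occurrences big_ord_recr/=.
  by case: (asboolP (A k w)) => [Akw|nAkw]; [rewrite mem_set// addn1|rewrite memNset// addn0].
by move=> [-> nAkw]; rewrite memNset.
Qed.

Lemma occurs_exactlySS k j : occurs_exactly k.+1 j.+1 =
  (occurs_exactly k j.+1 `\` A k) `|` (A k `&` occurs_exactly k j).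
Proof.
apply/seteqP; split => w; rewrite /occurs_exactly/= /occurrences big_ord_recr/=.
  case: (asboolP (A k w)) => [Akw|nAkw].
    by rewrite mem_set// addn1 => -[<-]; right.
  by rewrite memNset// addn0 => ->; left.
by move=> [[-> nAkw]|[Akw ->]]; [rewrite memNset// addn0|rewrite mem_set// addn1].
Qed.

(** A finite union over the values of the count, used both for measurability and for the union
    bound. *)
Lemma few_occurrencesE {R : realDomainType} k (c : R) :
  [set w | (occurrences k w)%:R < c] =
  \big[setU/set0]_(j < k.+1) (if j%:R < c then occurs_exactly k j else set0).
Proof.
rewrite -(bigcup_mkord _ (fun j => if j%:R < c then occurs_exactly k j else set0)).
apply/seteqP; split => w /=.
  move=> wc; exists (occurrences k w) => /=; last by rewrite wc.
  rewrite ltnS /occurrences (@leq_trans (\sum_(i < k) 1))//.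
    by apply: leq_sum => i _; exact: leq_b1.
  by rewrite sum1_card card_ord.
by move=> [j _]; case: ifP => // jc /= ->.
Qed.

End Occurrences.

Lemma measurable_occurs_exactly d (T : measurableType d) (A : nat -> set T) k j :
  (forall i, (i < k)%N -> measurable (A i)) -> measurable (occurs_exactly A k j).
Proof.
elim: k j => [|k IH] [|j] mA.
- by rewrite occurs_exactly00.
- by rewrite occurs_exactly0S.
- rewrite occurs_exactlyS0; apply: measurableD; last exact: mA.
  by apply: IH => i ik; exact/mA/ltnW.
- rewrite occurs_exactlySS.
  have mE l : measurable (occurs_exactly A k l) by apply: IH => i ik; exact/mA/ltnW.
  by apply: measurableU; [apply: measurableD => //; exact: mA|apply: measurableI => //; exact: mA].
Qed.

Lemma measurable_few_occurrences d (T : measurableType d) {R : realType}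
    (A : nat -> set T) k (c : R) : (forall i, measurable (A i)) ->
  measurable [set w | (occurrences A k w)%:R < c].
Proof.
move=> mA; rewrite few_occurrencesE; apply: bigsetU_measurable => j _.
by case: ifP => // _; exact: measurable_occurs_exactly.
Qed.

(** * Truncated moments and the lower tail *)

Section Chernoff.
Context {R : realType} {disp : measure_display} {T : measurableType disp}.
Variables (P : probability T R) (A : nat -> set T) (q : R).
Hypothesis mA : forall k, measurable (A k).
Hypothesis qA : forall k j,
  (q%:E * P (occurs_exactly A k j) <= P (A k `&` occurs_exactly A k j))%E.

Let pr (B : set T) : R := fine (P B).

Let prE B : measurable B -> P B = (pr B)%:E.
Proof. by move=> mB; rewrite /pr fineK// fin_num_measure. Qed.

Let pr_ge0 B : 0 <= pr B. Proof. exact: fine_ge0. Qed.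

Let mE k j : measurable (occurs_exactly A k j).
Proof. exact: measurable_occurs_exactly. Qed.

Let prD B C : measurable B -> measurable C -> pr (B `\` C) = pr B - pr (C `&` B).
Proof.
move=> mB mC; apply: EFin_inj; rewrite EFinB -!prE//; [|exact: measurableI|exact: measurableD].
by rewrite setIC measureD// ltey_eq fin_num_measure.
Qed.

(* Truncating the generating function of the number of occurrences at m costs
   the last term: the mass that moves from m to m + 1 leaves the sum. *)
Lemma occurrences_moment_step (b : R) k m :
  \sum_(j < m.+1) (1 - b) ^+ j * pr (occurs_exactly A k.+1 j) =
  \sum_(j < m.+1) (1 - b) ^+ j *
      (pr (occurs_exactly A k j) - b * pr (A k `&` occurs_exactly A k j))
  - (1 - b) ^+ m.+1 * pr (A k `&` occurs_exactly A k m).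
Proof.
elim: m => [|m IH].
  by rewrite !big_ord_recl !big_ord0 occurs_exactlyS0 prD//; ring.
rewrite big_ord_recr [in RHS]big_ord_recr /= IH occurs_exactlySS.
rewrite [pr (_ `|` _)](_ : _ = pr (occurs_exactly A k m.+1 `\` A k)
    + pr (A k `&` occurs_exactly A k m)); last first.
  apply: EFin_inj; rewrite EFinD -!prE; last first.
  - by apply: measurableU; [exact: measurableD|exact: measurableI].
  - exact: measurableD.
  - exact: measurableI.
  rewrite measureU//; [exact: measurableD|exact: measurableI|].
  by apply/seteqP; split => // w [[_ nA] [Aw _]].
by rewrite prD// !exprS; ring.
Qed.

(** Induction on [k]: the truncation term is nonpositive and is dropped, and [qA] shrinks every
    remaining summand by the factor [1 - b * q]. *)
Lemma occurrences_moment (b : R) k m : 0 <= b <= 1 -> 0 <= q <= 1 ->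
  \sum_(j < m.+1) (1 - b) ^+ j * pr (occurs_exactly A k j) <= (1 - b * q) ^+ k.
Proof.
move=> /andP[b0 b1] /andP[q0 q1]; elim: k => [|k IH].
  rewrite big_ord_recl big1 => [|j _].
    by rewrite occurs_exactly00 /pr probability_setT !expr0 mul1r addr0.
  by rewrite occurs_exactly0S /pr measure0 mulr0.
rewrite occurrences_moment_step.
apply: (@le_trans _ _ ((1 - b * q) *
    \sum_(j < m.+1) (1 - b) ^+ j * pr (occurs_exactly A k j))); last first.
  by rewrite exprS ler_wpM2l//; nra.
rewrite -[leRHS]subr0 lerB ?mulr_ge0 ?exprn_ge0 ?subr_ge0// mulr_sumr ler_sum// => j _.
rewrite mulrCA ler_wpM2l ?exprn_ge0 ?subr_ge0//.
have := qA k j; rewrite prE// prE; last exact: measurableI.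
by rewrite -EFinM lee_fin; set u := pr _; set v := pr _; nra.
Qed.

Lemma chernoff_lower_tail (b : R) K : 0 < b < 1 -> 0 <= q < 1 ->
  (P [set w | ((occurrences A K w)%:R < (1 - b) * q * K%:R)%R]
   <= (expR (- (b ^+ 2 / 2 * q * K%:R)))%:E)%E.
Proof.
move=> b01 q01; have /andP[b0 b1] := b01; have /andP[q0 q1] := q01.
have b10 : 0 < 1 - b by lra.
set c := _ * K%:R.
pose B j := if j%:R < c then occurs_exactly A K j else set0.
have mB j : measurable (B j) by rewrite /B; case: ifP.
rewrite few_occurrencesE.
apply: (le_trans (Boole_inequality P (A := B) _)) => //.
rewrite (eq_bigr (fun j : 'I_K.+1 => (pr (B j))%:E)) => [|j _]; last exact: prE.
rewrite sumEFin lee_fin; apply: (le_trans _ (chernoff_exponent K b01 q01)).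
rewrite -/c; apply: (@le_trans _ _ ((1 - b) `^ (- c) *
    \sum_(j < K.+1) (1 - b) ^+ j * pr (occurs_exactly A K j))); last first.
  by rewrite ler_wpM2l ?powR_ge0// occurrences_moment ?q0 ?(ltW b0) ?(ltW b1) ?(ltW q1).
rewrite mulr_sumr ler_sum// => j _; rewrite /B; case: ifPn => [jc|_]; last first.
  by rewrite {1}/pr measure0 !mulr_ge0 ?powR_ge0 ?exprn_ge0 ?pr_ge0 ?ltW.
(* Markov's inequality term by term: for [j < c] the weight, [1 - b] raised to the power [j - c], is
   at least 1, since the base lies in (0, 1). *)
rewrite mulrA ler_peMl ?pr_ge0//.
rewrite -powR_mulrn ?(ltW b10)// -powRD; last by rewrite (gt_eqF b10) implybT.
rewrite -[leLHS](powRr0 (1 - b)) ger_powR ?b10 ?gerBl ?(ltW b0)//.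
by rewrite addrC subr_le0 ltW.
Qed.

End Chernoff.

(** * Measurability *)

Section CompositionMeasurable.
Context {R : realType} {n : nat} {d : measure_display} {T : measurableType d}.
Variable X : T -> 'cV[R]_n.
Hypothesis mX : forall i, measurable_fun setT (fun w => X w i 0).

(** An open set is a countable union of rational boxes, and the preimage of a box is a finite
    intersection of conditions on the entries of [X]. *)
Lemma measurable_preimage_open (O : set 'cV[R]_n) : open O -> measurable (X @^-1` O).
Proof.
move=> oO.
pose box (qr : 'cV[rat]_n * rat) : set 'cV[R]_n :=
  [set v | forall i, `|v i 0 - ratr (qr.1 i 0)| < ratr qr.2].
(* Boxes not contained in [O] are replaced by the empty set, so the union may run over the whole
   countable index type. *)
pose S (qr : 'cV[rat]_n * rat) := if `[< box qr `<=` O >] then box qr else set0.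
have -> : X @^-1` O = \bigcup_qr X @^-1` (S qr).
  apply/seteqP; split => [w Ow|w [qr _]]; last first.
    by rewrite /S/=; case: asboolP => // bO /bO.
  have [/= e e0 eO] : nbhs_ball (X w) O by apply/nbhs_ballP; exact: open_nbhs_nbhs.
  (* The centre of the box is within [r] of [X w] in each entry, so points of the box are within
     [2 * r < e] of it. *)
  have [r] : exists r : rat, 0 < (ratr r : R) < e / 2.
    have [r] := rat_in_itvoo (divr_gt0 e0 (ltr0Sn R 1)).
    by rewrite in_itv/= => ?; exists r.
  move=> /andP[r0 re].
  have /choice[c hc] i : exists c : rat, `|X w i 0 - ratr c| < ratr r.
    have [c] := @rat_in_itvoo R (X w i 0 - ratr r) (X w i 0 + ratr r) ltac:(lra).
    by rewrite in_itv/= => /andP[c1 c2]; exists c; rewrite ltr_norml; lra.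
  exists (\col_i c i, r) => //=; rewrite /S; case: asboolP => [_ i|[]].
    by rewrite mxE.
  move=> v bv; apply: eO; split => // i j; rewrite ord1 /ball/=.
  have := bv i; rewrite /= mxE => vi; have := hc i.
  rewrite (_ : X w i 0 - v i 0 = (X w i 0 - ratr (c i)) - (v i 0 - ratr (c i))); last by ring.
  by move=> h; apply: le_lt_trans (ler_normB _ _) _; lra.
apply: countable_bigcupT_measurable; first exact: countableP.
move=> qr; rewrite /S; case: ifP => _; last by rewrite preimage_set0.
rewrite (_ : _ @^-1` _ = \bigcap_(i in [set: 'I_n])
    (fun w => X w i 0) @^-1` ball (ratr (qr.1 i 0) : R) (ratr qr.2)); last first.
  apply/seteqP; split => w /= h i; last by have := h i I; rewrite /ball/= distrC.
  by move=> _; have := h i; rewrite /ball/= distrC.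
apply: fin_bigcap_measurable => // i _; rewrite -[_ @^-1` _]setTI.
by apply: mX => //; exact: measurable_ball.
Qed.

Lemma measurable_continuous_comp (g : 'cV[R]_n -> R) :
  continuous g -> measurable_fun setT (g \o X).
Proof.
move=> /continuousP cg.
apply: (measurability _ (RGenOpens.measurableE R)) => _ [_ [a [b ->]] <-].
rewrite setTI comp_preimage; apply: measurable_preimage_open.
exact/cg/interval_open.
Qed.

End CompositionMeasurable.

Section MatrixMeasurable.
Context {R : realType} {d : measure_display} {T : measurableType d}.

Lemma measurable_mulmx_entry m n k (X : T -> 'M[R]_(m, n)) (Y : T -> 'M[R]_(n, k)) i j :
  (forall i j, measurable_fun setT (fun w => X w i j)) ->
  (forall i j, measurable_fun setT (fun w => Y w i j)) ->
  measurable_fun setT (fun w => (X w *m Y w) i j).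
Proof.
move=> mX mY.
rewrite (_ : (fun w => _) = (fun w => \sum_l X w i l * Y w l j)); last first.
  by apply/funext => w; rewrite mxE.
by apply: measurable_sum => l; exact: measurable_funM.
Qed.

Lemma measurable_fnorm m n (X : T -> 'M[R]_(m, n)) :
  (forall i j, measurable_fun setT (fun w => X w i j)) ->
  measurable_fun setT (fun w => fnorm (X w)).
Proof.
move=> mX; apply: (measurableT_comp (continuous_measurable_fun _)).
  exact: sqrt_continuous.
apply: measurable_sum => i; apply: measurable_sum => j.
exact: measurable_funX.
Qed.

Lemma measurable_grad_entry n (g : 'cV[R]_n -> R) (X : T -> 'cV[R]_n) :
  continuous (grad g) -> (forall i, measurable_fun setT (fun w => X w i 0)) ->
  forall i j, measurable_fun setT (fun w => grad g (X w) i j).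
Proof.
move=> cg mX i j; apply: (measurable_continuous_comp mX (g := fun y => grad g y i j)).
move=> y; apply: (@continuous_comp _ _ _ (grad g) (fun M => M i j)); first exact: cg.
exact: coord_continuous.
Qed.

Lemma measurable_bigmin (I : Type) (r : seq I) (g0 : T -> R) (g : I -> T -> R) :
  measurable_fun setT g0 -> (forall i, measurable_fun setT (g i)) ->
  measurable_fun setT (fun w => \big[Num.min/g0 w]_(i <- r) g i w).
Proof.
move=> mg0 mg; elim: r => [|i r IH].
  by under eq_fun do rewrite big_nil.
by under eq_fun do rewrite big_cons; exact: measurable_minr.
Qed.

End MatrixMeasurable.

(** * The random process *)

Section History.
Context {R : realType} {disp : measure_display} {T : measurableType disp}.
Context {n p : nat}.
Variable U : nat -> T -> 'M[R]_(n, p).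

Lemma sub_history k l : (k <= l)%N -> <<s history U k >> `<=` <<s history U l >>.
Proof.
move=> kl; apply: sub_sigma_algebra2 => _ [i [a [b [ik [B mB <-]]]]].
by exists i, a, b; split; [exact: leq_trans kl|exists B].
Qed.

Lemma measurable_fun_history k l (g : T -> R) : (k <= l)%N ->
  measurable_fun [set: g_sigma_algebraType (history U k)] g ->
  measurable_fun [set: g_sigma_algebraType (history U l)] g.
Proof. by move=> kl mg _ B mB; apply: (sub_history kl); exact: mg. Qed.

Lemma measurable_history_entry k l i j : (k < l)%N ->
  measurable_fun [set: g_sigma_algebraType (history U l)] (fun w => U k w i j).
Proof.
by move=> kl _ B mB; apply: sub_sigma_algebra; exists k, i, j; split => //; exists B.
Qed.

Lemma history_measurable k B :
  (forall k i j, measurable_fun [set: T] (fun w => U k w i j)) ->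
  <<s history U k >> B -> measurable B.
Proof.
move=> mU; move: B; apply: smallest_sub; first exact: sigma_algebra_measurable.
by move=> _ [i [a [b [_ [B mB <-]]]]]; exact: mU.
Qed.

End History.

(** * From conditional probabilities to joint events *)

Section ConditionalProbability.
Context {R : realType} {disp : measure_display} {T : measurableType disp}.
Variable P : probability T R.

(* The version q may be negative on a null set, hence the detour through
   max q c. *)
Lemma cond_prob_ge (G : set (set T)) (A E : set T) (q : T -> R) (c : R) :
  is_cond_prob P G A q -> {ae P, forall w, c <= q w} -> 0 <= c ->
  <<s G >> E -> measurable E -> (c%:E * P E <= P (A `&` E))%E.
Proof.
move=> [_ /measurable_int mq qE] cq c0 GE mE.
rewrite -qE// -integral_cst//.
have mqE : measurable_fun E (EFin \o q) by exact: measurable_funTS.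
have mmax : measurable_fun E (fun w => (Num.max (q w) c)%:E).
  by apply/measurable_EFinP/measurable_maxr => //; exact/measurable_EFinP.
rewrite [leRHS](@ae_eq_integral _ _ _ P E (fun w => (Num.max (q w) c)%:E))//.
- apply: ge0_le_integral => //.
  by move=> w _; rewrite lee_fin le_max lexx orbT.
by apply: filterS cq => w cw _; rewrite max_l.
Qed.

End ConditionalProbability.

(** * Adaptedness, summed decrease and the gradient bound *)

Section Convergence.
Context {R : realType} {n p : nat}.
Context {disp : measure_display} {T : measurableType disp}.
Variables (P : probability T R) (f psi : 'cV[R]_n -> R) (UU : set 'M[R]_(n, p)).
Variables (L : 'M[R]_(n, p) -> R) (x0 : 'cV[R]_n) (U : nat -> T -> 'M[R]_(n, p)).
Variables (eta : nat -> T -> R) (D : nat -> T -> 'cV[R]_p) (x : nat -> T -> 'cV[R]_n).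
Variables (alpha delta HFmax eta_min : R).
Let F := f \+ psi.
Let C := alpha ^+ 2 * eta_min / (2 * HFmax ^+ 2).
Hypotheses (asA : assumption_A f psi UU L) (scpg : SCPG U f psi UU L eta x0 D x).
Let aligned k : set T := [set w | well_aligned f psi alpha (x k w) (U k w)].

Let gradF_E y : grad F y = grad f y + grad psi y.
Proof. by case: asA => _ [[df _] _] [[dpsi _] _ _] _; exact: gradD. Qed.

(** By induction: [x k.+1] is computed from [x k], [U k] and [D k], all determined by [U 0], ...,
    [U k]. *)
Lemma measurable_iterate k i :
  measurable_fun [set: g_sigma_algebraType (history U k)] (fun w => x k w i 0).
Proof.
elim: k i => [|k IH] i.
  rewrite (_ : (fun w => _) = cst (x0 i 0))//.
  by apply/funext => w; rewrite (SCPG_init scpg).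
rewrite (_ : (fun w => _) = (fun w => x k w i 0 + (U k w *m D k w) i 0)); last first.
  by apply/funext => w; rewrite (SCPG_step scpg) mxE.
apply: (@measurable_funD _ (g_sigma_algebraType (history U k.+1))).
  exact: measurable_fun_history (IH i).
apply: (@measurable_mulmx_entry _ _ (g_sigma_algebraType (history U k.+1))) => a b.
  exact: measurable_history_entry.
by rewrite ord1; exact: (SCPG_select scpg).
Qed.

Lemma measurable_gradF k i j :
  measurable_fun [set: g_sigma_algebraType (history U k)] (fun w => grad F (x k w) i j).
Proof.
case: asA => _ [[_ cf] _] [[_ cpsi] _ _] _.
rewrite (_ : (fun w => _) = (fun w => grad f (x k w) i j + grad psi (x k w) i j)); last first.
  by apply/funext => w; rewrite gradF_E mxE.
by apply: (@measurable_funD _ (g_sigma_algebraType (history U k)));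
  apply: (@measurable_grad_entry _ _ (g_sigma_algebraType (history U k))) => // l;
  exact: measurable_iterate.
Qed.

(** The index is [k.+1] because alignment at step [k] involves [U k] itself. The count of aligned
    steps before [k] then depends only on the history at [k], as conditioning requires. *)
Lemma measurable_aligned k : <<s history U k.+1 >> (aligned k).
Proof.
have mg i j : measurable_fun [set: g_sigma_algebraType (history U k.+1)]
    (fun w => grad F (x k w) i j).
  exact: (measurable_fun_history (leqnSn k) (@measurable_gradF k i j)).
have : measurable_fun [set: g_sigma_algebraType (history U k.+1)]
    (fun w => alpha * fnorm (grad F (x k w))
    <= fnorm ((U k w)^T *m grad F (x k w))).
  apply: (@measurable_fun_ler _ (g_sigma_algebraType (history U k.+1))).
    by apply: (@measurable_funM _ (g_sigma_algebraType (history U k.+1))) => //;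
      exact: (@measurable_fnorm _ _ (g_sigma_algebraType (history U k.+1))).
  apply: (@measurable_fnorm _ _ (g_sigma_algebraType (history U k.+1))) => i j.
  apply: (@measurable_mulmx_entry _ _ (g_sigma_algebraType (history U k.+1))) => // a b.
  under eq_fun do rewrite mxE.
  exact: measurable_history_entry.
move=> /(_ measurableT [set true] I).
by rewrite setTI.
Qed.

Let mT k B : <<s history U k >> B -> measurable B.
Proof. exact/history_measurable/(SCPG_rand scpg). Qed.

Lemma measurable_aligned_count k j : <<s history U k >> (occurs_exactly aligned k j).
Proof.
apply: (@measurable_occurs_exactly _ (g_sigma_algebraType (history U k))) => i ik.
exact: (sub_history ik (@measurable_aligned i)).
Qed.

Hypotheses (bS : bounded_set (sublevel F x0)) (alpha0 : 0 < alpha) (HFmax0 : 0 < HFmax).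
Hypotheses (eta_min0 : 0 < eta_min).
Hypothesis HFle : forall k w,
  HF f psi x0 (U k w) (Hf psi UU (L (U k w)) (eta k w)) <= HFmax.
Hypothesis eta_ge : forall k w, eta_min <= eta k w.

Lemma iterate_sublevel k w : sublevel F x0 (x k w).
Proof.
elim: k => [|k IH]; first by rewrite (SCPG_init scpg) /sublevel/=.
rewrite (SCPG_step scpg).
apply: (step_sublevel asA (SCPG_family scpg k w) (SCPG_argmin scpg k w)) => //.
exact/ltW/(SCPG_eta scpg).
Qed.

(** Telescoping: an aligned step decreases [F] by at least [C * m], and no other step increases
    it. *)
Lemma sum_aligned_decrease k w (m : R) : 0 <= m ->
  (forall i, (i < k)%N -> m <= fnorm (grad F (x i w)) ^+ 2) ->
  C * m * (occurrences aligned k w)%:R <= F x0 - F (x k w).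
Proof.
have C0 : 0 <= C by rewrite divr_ge0 ?mulr_ge0 ?exprn_ge0// ltW.
move=> m0; elim: k => [|k IH] hm.
  by rewrite /occurrences big_ord0 mulr0 (SCPG_init scpg) subrr.
rewrite /occurrences big_ord_recr/= natrD mulrDr.
have {IH} := IH (fun i ik => hm i (ltnW ik)); rewrite -/(occurrences aligned k w).
have dmin := SCPG_argmin scpg k w.
have UUU := SCPG_family scpg k w.
have eta0 : 0 <= eta k w by exact/ltW/(SCPG_eta scpg).
suff : C * m * (w \in aligned k)%:R <= F (x k w) - F (x k.+1 w) by lra.
rewrite (SCPG_step scpg).
case: (asboolP (aligned k w)) => [al|nal].
  rewrite mem_set// mulr1.
  have emin : 0 <= eta_min <= eta k w by rewrite ltW ?eta_ge.
  apply: le_trans (step_aligned_decrease asA bS UUU dmin eta0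
    (iterate_sublevel k w) (ltW alpha0) HFmax0 emin (HFle k w) al).
  by rewrite ler_wpM2l// hm.
rewrite memNset// mulr0 subr_ge0.
apply: le_trans (step_descent asA UUU dmin) _.
by rewrite gerBl mulr_ge0 ?divr_ge0 ?sqr_ge0.
Qed.

Hypotheses (delta01 : 0 < delta < 1) (asB : assumption_B P U f psi x alpha delta).

Lemma aligned_cond k j : ((1 - delta)%:E * P (occurs_exactly aligned k j)
  <= P (aligned k `&` occurs_exactly aligned k j))%E.
Proof.
have [q qc qd] := asB k.
have Ek := @measurable_aligned_count k j.
apply: (cond_prob_ge qc qd) => //; last exact: mT Ek.
by case/andP: delta01 => _ d1; rewrite subr_ge0 ltW.
Qed.

Lemma min_grad_aligned K beta w : 0 < beta < 1 ->
  (1 - beta) * (1 - delta) * K.+1%:R <= (occurrences aligned K.+1 w)%:R ->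
  \big[Num.min/fnorm (grad F (x 0%N w)) ^+ 2]_(i < K.+1) fnorm (grad F (x i w)) ^+ 2
  <= (F x0 - inf (range F)) / (C * (1 - beta) * (1 - delta) * K.+1%:R).
Proof.
move=> /andP[b0 b1] hN; have /andP[_ d1] := delta01.
(* The default value of the minimum is its own term at index 0, so [m] is the true minimum. *)
set m := \big[_/_]_(_ < _) _.
have C0 : 0 < C by rewrite divr_gt0 ?mulr_gt0 ?exprn_gt0.
have c0 : 0 < (1 - beta) * (1 - delta) * K.+1%:R by rewrite !mulr_gt0 ?ltr0Sn; lra.
have m0 : 0 <= m by apply: le_bigmin => [|i _]; exact: sqr_ge0.
have hm i : (i < K.+1)%N -> m <= fnorm (grad F (x i w)) ^+ 2.
  by move=> iK; apply: (bigmin_le_cond _ _ (j := Ordinal iK)).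
have := sum_aligned_decrease m0 hm.
(* The attained minimum bounds the range below, so [inf] is a genuine lower bound. *)
have : inf (range F) <= F (x K.+1 w).
  case: asA => _ _ _ [xs Fxs]; apply: ge_inf; last by exists (x K.+1 w).
  by exists (F xs) => _ [y _ <-]; exact: Fxs.
set N := (1 - beta) * (1 - delta) * K.+1%:R in hN c0 *.
rewrite (_ : C * _ * _ * _ = C * N); last by rewrite /N !mulrA.
have : C * m * N <= C * m * (occurrences aligned K.+1 w)%:R.
  by rewrite ler_wpM2l// mulr_ge0// ltW.
by rewrite ler_pdivlMr ?(mulr_gt0 C0 c0)// (mulrCA m) !mulrA => *; lra.
Qed.

End Convergence.

Theorem theorem1 (R : realType) (n p : nat)
    (disp : measure_display) (T : measurableType disp) (P : probability T R)
    (f psi : 'cV[R]_n -> R) (UU : set 'M[R]_(n, p)) (L : 'M[R]_(n, p) -> R)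
    (x0 : 'cV[R]_n) (U : nat -> T -> 'M[R]_(n, p)) (eta : nat -> T -> R)
    (D : nat -> T -> 'cV[R]_p) (x : nat -> T -> 'cV[R]_n)
    (alpha delta HFmax eta_min : R)
    (F := f \+ psi) (Fstar := inf (range F))
    (C := alpha ^+ 2 * eta_min / (2 * HFmax ^+ 2)) :
  assumption_A f psi UU L ->
  SCPG U f psi UU L eta x0 D x ->
  0 < alpha < 1 ->
  0 < delta < 1 ->
  assumption_B P U f psi x alpha delta ->
  bounded_set (sublevel F x0) ->
  0 < HFmax ->
  0 < eta_min ->
  (forall k w,
    HF f psi x0 (U k w) (Hf psi UU (L (U k w)) (eta k w)) <= HFmax) ->
  (forall k w, eta_min <= eta k w) ->
  forall (K : nat) (beta : R), 0 < beta < 1 ->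
  ((1 - expR (- (beta ^+ 2 / 2 * (1 - delta) * K.+1%:R)))%:E <=
   P [set w |
       (\big[Num.min/fnorm (grad F (x 0%N w)) ^+ 2]_(i < K.+1)
          fnorm (grad F (x i w)) ^+ 2
       <= (F x0 - Fstar) / (C * (1 - beta) * (1 - delta) * K.+1%:R))%R])%E.
Proof.
move=> asA scpg /andP[alpha0 _] delta01 asB bS HFmax0 eta_min0 HFle eta_ge K beta beta01.
pose aligned k : set T := [set w | well_aligned f psi alpha (x k w) (U k w)].
have mT k B : <<s history U k >> B -> measurable B.
  exact/history_measurable/(SCPG_rand scpg).
have mal k : measurable (aligned k) by exact: mT (measurable_aligned alpha asA scpg (k := k)).
set target := [set w | _].
pose few := [set w | (occurrences aligned K.+1 w)%:R < (1 - beta) * (1 - delta) * K.+1%:R].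
have mfew : measurable few by exact: measurable_few_occurrences.
have mgrad k : measurable_fun [set: T] (fun w => fnorm (grad F (x k w)) ^+ 2).
  apply: measurable_funX; apply: measurable_fnorm => i j _ B mB.
  by apply: (mT k); exact: (measurable_gradF asA scpg).
have mtarget : measurable target.
  have := measurable_fun_ler
    (measurable_bigmin (index_enum 'I_K.+1) (mgrad 0%N) (fun i => mgrad i))
    (measurable_cst ((F x0 - Fstar) / (C * (1 - beta) * (1 - delta) * K.+1%:R))).
  by move=> /(_ measurableT [set true] I); rewrite setTI.
have fewP : (P few <= (expR (- (beta ^+ 2 / 2 * (1 - delta) * K.+1%:R)))%:E)%E.
  apply: chernoff_lower_tail => //; [|lra].
  by move=> k j; exact: (aligned_cond asA scpg delta01 asB).
(* Pathwise and deterministic: enough aligned steps force a small gradient. Probability enters only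
   through the bound on [few]. *)
have sub : ~` few `<=` target.
  move=> w /negP; rewrite -leNgt => hN.
  exact: (min_grad_aligned asA scpg bS alpha0 HFmax0 eta_min0 HFle eta_ge delta01 beta01 hN).
have : (P (~` few) <= P target)%E.
  by apply: le_measure => //; rewrite inE//; exact: measurableC.
by apply: le_trans; rewrite probability_setC// EFinB leeB.
Qed.
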